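(* Let $\hat p:\mathbb R^C\to\mathbb R^C$ be the softmax mapping $\hat p_i(s)=\exp(s_i)/\sum_{j=1}^C\exp(s_j)$. Then its Jacobian $J_{\mathrm{sm}}(s)=\nabla_s\hat p(s)$ satisfies, for all $s\in\mathbb R^C$, $$J_{\mathrm{sm}}(s)=\mathrm{diag}(\hat p(s))-\hat p(s)\hat p(s)^\top,\qquad \|J_{\mathrm{sm}}(s)\|_2\le\tfrac12 .$$
   Context: $\|\cdot\|_2$ is the spectral (operator) norm of a matrix. *)

(* Defs.v *)
From HB Require Import structures.
From mathcomp Require Import all_boot all_order all_algebra.
From mathcomp Require Import all_classical all_reals all_analysis.

Set Implicit Arguments.
Unset Strict Implicit.
Unset Printing Implicit Defensive.

Import Order.TTheory GRing.Theory Num.Theory.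
Import numFieldNormedType.Exports.

Local Open Scope classical_set_scope.
Local Open Scope ring_scope.

(* Points of R^C are row vectors, because the library's ['J f s] is defined
   for maps between row-vector spaces. *)
Definition softmax (R : realType) (C : nat) (s : 'rV[R]_C) : 'rV[R]_C :=
  \row_i (expR (s 0 i) / \sum_j expR (s 0 j)).

(* The library's ['J f s] acts on the right of row vectors, so its (i, j) entry
   is the partial derivative of [f_j] in direction i; the transpose is the usual
   Jacobian, with (i, j) entry the partial derivative of [f_i] in direction j. *)
Definition Jmx (R : realType) (m n : nat) (f : 'rV[R]_n -> 'rV[R]_m)
  (s : 'rV[R]_n) : 'M[R]_(m, n) := ('J f s)^T.

(* Not [`|x|], which is the sup norm on matrices. *)
Definition l2norm (R : realType) (n : nat) (x : 'cV[R]_n) : R :=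
  Num.sqrt (\sum_i x i 0 ^+ 2).

Definition unit_ball_image (R : realType) (m n : nat) (A : 'M[R]_(m, n))
  : set R := [set l2norm (A *m x) | x in [set x | l2norm x <= 1]].

Definition spectral_norm (R : realType) (m n : nat) (A : 'M[R]_(m, n)) : R :=
  sup (unit_ball_image A).

(* The real-valued [sup] is 0 on sets without a supremum; this never happens
   in [spectral_norm]. *)
Lemma has_sup_unit_ball_image (R : realType) (m n : nat) (A : 'M[R]_(m, n)) :
  has_sup (unit_ball_image A).
Proof.
split.
  exists (l2norm (A *m 0)), 0 => //=.
  by rewrite /l2norm big1 ?sqrtr0// => i _; rewrite mxE expr0n.
exists (Num.sqrt (\sum_i (\sum_j `|A i j|) ^+ 2)) => _ [x /= x1 <-].
have xj1 j : `|x j 0| <= 1.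
  apply: le_trans x1; rewrite -sqrtr_sqr ler_wsqrtr//.
  by rewrite (bigD1 j)//= lerDl sumr_ge0// => i _; exact: sqr_ge0.
rewrite ler_wsqrtr// ler_sum// => i _; rewrite -real_normK ?num_real//.
rewrite lerXn2r ?nnegrE ?sumr_ge0// mxE (le_trans (ler_norm_sum _ _ _))//.
by rewrite ler_sum// => j _; rewrite normrM ler_piMr.
Qed.

(* Main.v *)
(* With p = softmax s, the quotient rule gives d p_i = p_i (d s_i - sum_k p_k d s_k),
   hence the formula for the Jacobian J. Since p is a probability vector, J is symmetric
   and the absolute values in its i-th row add up to 2 p_i (1 - p_i) <= 1/2. The Schur test
   bounds the spectral norm of a symmetric matrix by its largest absolute row sum. *)
Require Import Defs.
From HB Require Import structures.
From mathcomp Require Import all_boot all_order all_algebra.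
From mathcomp Require Import all_classical all_reals all_analysis.
From mathcomp Require Import ring lra.
Import Order.TTheory GRing.Theory Num.Theory.
Import numFieldNormedType.Exports.
Local Open Scope classical_set_scope.
Local Open Scope ring_scope.

Lemma is_diff_sum {R : realType} {V W : normedModType R} {n : nat}
    {f df : 'I_n -> V -> W} {x : V} :
  (forall i, is_diff x (f i) (df i)) ->
  is_diff x (fun y => \sum_i f i y) (fun y => \sum_i df i y).
Proof.
move=> fdf.
have -> : (fun y => \sum_i f i y) = \sum_i f i.
  by apply/funext => y; rewrite fct_sumE.
have -> : (fun y => \sum_i df i y) = \sum_i df i.
  by apply/funext => y; rewrite fct_sumE.
apply: (big_ind2 (fun g dg => is_diff x g dg)) => //.
- exact: is_diff_cst.
- by move=> *; exact: is_diffD.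
Qed.

Lemma differentiable_row (R : realType) (V : normedModType R) (n : nat)
    (f : V -> 'rV[R]_n) (x : V) :
  (forall i, differentiable (fun y => f y 0 i : R) x) -> differentiable f x.
Proof.
move=> df.
have -> : f = \sum_i (fun y => f y 0 i *: delta_mx 0 i).
  by apply/funext => y; rewrite fct_sumE; exact: row_sum_delta.
by apply: differentiable_sum => i; exact: differentiableZl.
Qed.

(** Row [i] of ['J f x] is the derivative of [f] along the [i]-th basis vector, and directional
    derivatives are taken entrywise. This reduces the Jacobian to scalar differentials. *)
Lemma jacobianE (R : realType) (m n : nat) (f : 'rV[R]_m -> 'rV[R]_n)
    (x : 'rV[R]_m) (i : 'I_m) (j : 'I_n) :
  differentiable f x ->
  ('J f x) i j = 'd (fun y => f y 0 j : R) x (delta_mx 0 i).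
Proof.
move=> df; rewrite /jacobian mxE -deriveE// derive_mx; last exact: diff_derivable.
rewrite mxE deriveE//.
exact: (differentiable_comp df (differentiable_coord _ _ _)).
Qed.

Lemma is_diff_expR_coord {R : realType} {n : nat} (s : 'rV[R]_n) (i : 'I_n) :
  is_diff s (fun t : 'rV[R]_n => expR (t 0 i) : R)
    (fun v => expR (s 0 i) * v 0 i).
Proof.
have dcoord : is_diff s (fun t : 'rV[R]_n => t 0 i : R) (fun v => v 0 i).
  apply: DiffDef; first exact: differentiable_coord.
  apply/funext => v.
  (* The derivative of the identity along [v] is [v]; its entry at [i] is the differential of the
     coordinate map. *)
  rewrite -deriveE; last exact: differentiable_coord.
  have /matrixP/(_ 0 i) := derive_mx (@derivable_id _ _ s v).
  by rewrite mxE derive_id.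
have dexp : is_diff (s 0 i) (expR : R -> R) (fun h => h *: expR (s 0 i)).
  apply: DiffDef; first exact/derivable1_diffP.
  by rewrite diff1E ?derive1E ?derive_val//; exact/derivable1_diffP.
apply: is_diff_eq (is_diff_comp dcoord dexp) _.
by apply/funext => v /=; rewrite mulrC.
Qed.

Lemma is_diff_div {R : realType} {V : normedModType R} {f g df dg : V -> R}
    {x : V} :
  is_diff x f df -> is_diff x g dg -> g x != 0 ->
  is_diff x (fun y => f y / g y)
    (fun v => df v / g x - f x * dg v / g x ^+ 2).
Proof.
move=> fdf gdg gx0.
have dginv : is_diff x (fun y => (g y)^-1) (fun v => - g x ^- 2 * dg v).
  apply: DiffDef; first exact: differentiableV.
  by rewrite diffV// diff_val.
apply: is_diff_eq (is_diffM fdf dginv) _; apply/funext => v.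
by rewrite !fctE /GRing.scale/=; ring.
Qed.

Section softmax.
Context {R : realType} {C : nat}.
Implicit Types s t v : 'rV[R]_C.

(** The index argument witnesses [C > 0]: for [C = 0] the sum is empty, hence zero. *)
Lemma sum_expR_gt0 s : 'I_C -> 0 < \sum_j expR (s 0 j).
Proof.
by move=> i; rewrite (bigD1 i)//= ltr_wpDr ?expR_gt0// sumr_ge0//.
Qed.

Lemma softmax_ge0 s i : 0 <= softmax s 0 i.
Proof. by rewrite mxE divr_ge0 ?expR_ge0// ltW// sum_expR_gt0. Qed.

Lemma sum_softmax s : 'I_C -> \sum_i softmax s 0 i = 1.
Proof.
move=> i; under eq_bigr do rewrite mxE.
by rewrite -mulr_suml divff// gt_eqF// sum_expR_gt0.
Qed.

Lemma is_diff_softmax s i :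
  is_diff s (fun t => softmax t 0 i : R)
    (fun v => softmax s 0 i * (v 0 i - \sum_k softmax s 0 k * v 0 k)).
Proof.
have S0 := sum_expR_gt0 s i.
have -> : (fun t => softmax t 0 i : R) =
    (fun t => expR (t 0 i) / \sum_j expR (t 0 j)).
  by apply/funext => t; rewrite mxE.
apply: is_diff_eq (is_diff_div (is_diff_expR_coord s i)
  (is_diff_sum (is_diff_expR_coord s)) (lt0r_neq0 S0)) _.
apply/funext => v; rewrite mxE.
(* The common denominator is pulled out of the weighted sum, leaving an identity of fractions for
   [field]. *)
under [X in _ * (_ - X)]eq_bigr do rewrite mxE mulrAC.
by rewrite -mulr_suml; field; exact: lt0r_neq0.
Qed.

Lemma differentiable_softmax s : differentiable (@softmax R C) s.
Proof.
by apply: differentiable_row => i; have [] := is_diff_softmax s i.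
Qed.

Lemma Jmx_softmax s : Jmx (@softmax R C) s =
  diag_mx (softmax s) - (softmax s)^T *m softmax s.
Proof.
apply/matrixP => j i; rewrite mxE jacobianE; last exact: differentiable_softmax.
have [_ ->] := is_diff_softmax s j; move: (softmax s) => p.
(* On the [i]-th basis vector, only the term [k = i] of the weighted sum survives. *)
rewrite (bigD1 i)//= big1 => [|k ki]; last by rewrite mxE (negbTE ki) mulr0.
rewrite !mxE big_ord1 !mxE !eqxx/= mulr1 addr0 mulrBr [j == i]eq_sym.
by case: eqVneq => [->|_]; rewrite ?mulr1 ?mulr0 ?mulr1n ?mulr0n// mulrC.
Qed.

End softmax.

(** Cauchy-Schwarz with weights of total at most [b]. It comes from expanding the nonnegative sum of
    [w i * (b * y i - S) ^+ 2]; centring with [b] instead of the exact total avoids a separate case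
    for total weight zero. *)
Lemma sqr_sum_le {R : realFieldType} {n : nat} {w : 'I_n -> R} (y : 'I_n -> R)
    {b : R} :
  (forall i, 0 <= w i) -> 0 < b -> \sum_i w i <= b ->
  (\sum_i w i * y i) ^+ 2 <= b * \sum_i w i * y i ^+ 2.
Proof.
move=> w0 b0 wb; set S := \sum_i w i * y i.
have expand (c : R) : \sum_i w i * (b * y i - c) ^+ 2 =
    b ^+ 2 * (\sum_i w i * y i ^+ 2) -
    2 * b * c * (\sum_i w i * y i) + c ^+ 2 * \sum_i w i.
  rewrite !mulr_sumr -sumrB -big_split/=.
  by apply: eq_bigr => i _; ring.
have : 0 <= \sum_i w i * (b * y i - S) ^+ 2.
  by apply: sumr_ge0 => i _; rewrite mulr_ge0 ?sqr_ge0.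
have : S ^+ 2 * \sum_i w i <= S ^+ 2 * b by rewrite ler_wpM2l ?sqr_ge0.
(* With total weight at most [b], the expansion gives [b * S ^+ 2 <= b ^+ 2 * \sum_i w i * y i ^+
   2], and one factor [b] cancels. *)
by rewrite expand -/S -(ler_pM2l b0 (S ^+ 2)); nra.
Qed.

Lemma spectral_norm_le_row_sum (R : realType) (n : nat) (A : 'M[R]_n) (b : R) :
  A^T = A -> 0 < b -> (forall i, \sum_j `|A i j| <= b) ->
  spectral_norm A <= b.
Proof.
move=> symA b0 Ab.
have Aij i j : A i j = A j i by rewrite -[in LHS]symA mxE.
apply: ge_sup => [|_ [x /= x1 <-]]; first by have [] := has_sup_unit_ball_image A.
have x21 : \sum_i x i 0 ^+ 2 <= 1.
  by rewrite -(@ler_sqrt _ _ 1) ?sqrtr1// ler01.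
rewrite /l2norm -[leRHS](ger0_norm (ltW b0)) -sqrtr_sqr ler_wsqrtr//.
(* Weighted Cauchy-Schwarz on each row, with weights [|A i j|] and values [|x j 0|]. *)
apply: (@le_trans _ _ (\sum_i b * \sum_j `|A i j| * `|x j 0| ^+ 2)).
  apply: ler_sum => i _; apply: le_trans (sqr_sum_le _ _ b0 (Ab i)) => //.
  rewrite -real_normK ?num_real// lerXn2r ?nnegrE ?sumr_ge0//.
  rewrite mxE (le_trans (ler_norm_sum _ _ _))//.
  by rewrite ler_sum// => j _; rewrite normrM.
rewrite -mulr_sumr expr2 ler_pM2l// exchange_big/=.
(* After the exchange of sums, column sums of [|A i j|] appear; by symmetry they are row sums, so
   again at most [b]. *)
apply: (@le_trans _ _ (\sum_j b * x j 0 ^+ 2)).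
  apply: ler_sum => j _; rewrite -mulr_suml real_normK ?num_real//.
  by rewrite ler_wpM2r ?sqr_ge0//; under eq_bigr do rewrite Aij.
by rewrite -mulr_sumr ler_piMr// ltW.
Qed.

(** The diagonal entry [p_i (1 - p_i)] is nonnegative and the others, [- p_i p_j], are nonpositive.
    As the [p_j] with [j != i] add up to [1 - p_i], both groups contribute the same amount. *)
Lemma softmax_row_sum (R : realType) (C : nat) (s : 'rV[R]_C) (i : 'I_C) :
  \sum_j `|(diag_mx (softmax s) - (softmax s)^T *m softmax s) i j|
    = 2 * softmax s 0 i * (1 - softmax s 0 i).
Proof.
have p0 := softmax_ge0 s.
have p1 : \sum_(j | j != i) softmax s 0 j = 1 - softmax s 0 i.
  by rewrite -(sum_softmax s i) [in RHS](bigD1 i)//= addrAC subrr add0r.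
have pi1 : softmax s 0 i <= 1 by rewrite -subr_ge0 -p1 sumr_ge0.
have Jij j : (diag_mx (softmax s) - (softmax s)^T *m softmax s) i j =
    softmax s 0 i *+ (i == j) - softmax s 0 i * softmax s 0 j.
  by move: (softmax s) => p; rewrite !mxE big_ord1 !mxE.
rewrite (bigD1 i)//= Jij eqxx mulr1n -{1}(mulr1 (softmax s 0 i)) -mulrBr.
rewrite ger0_norm; last by rewrite mulr_ge0 ?subr_ge0.
have -> : \sum_(j | j != i) `|(diag_mx (softmax s) -
    (softmax s)^T *m softmax s) i j| = softmax s 0 i * (1 - softmax s 0 i).
  rewrite -p1 mulr_sumr; apply: eq_bigr => j ji.
  by rewrite Jij eq_sym (negbTE ji) sub0r normrN ger0_norm ?mulr_ge0.
by ring.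
Qed.

Theorem lemmaB5 (R : realType) (C : nat) (s : 'rV[R]_C) :
  [/\ differentiable (@softmax R C) s,
      Jmx (@softmax R C) s
        = diag_mx (softmax s) - (softmax s)^T *m softmax s
    & spectral_norm (Jmx (@softmax R C) s) <= 1 / 2].
Proof.
split; [exact: differentiable_softmax | exact: Jmx_softmax |].
rewrite Jmx_softmax; apply: spectral_norm_le_row_sum => [||i].
- by rewrite linearB/= tr_diag_mx trmx_mul trmxK.
- by rewrite divr_gt0.
(* The gap [1/2 - 2 p_i (1 - p_i)] equals [2 (p_i - 1/2)^2]. *)
- rewrite softmax_row_sum; have := sqr_ge0 (softmax s 0 i - 1 / 2); nra.
Qed.
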